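(* Let $n\ge2$, $0<\alpha\le2$, $\beta\ge0$, $\lambda,\lambda_0>0$ and $\mu,\mu_0>0$. Let $\{G_t=(V,E_t),\,t\ge0\}$ be the stationary network Markov chain on graphs with vertex set $V=\{1,\dots,n\}$ with these parameters (see context). Let $(d,\Delta)$ be a random vector having the same distribution as $(d_v(G_t),\Delta_v(G_t))$, where $d_v(G_t)$ is the degree of $v$ in $G_t$ and $\Delta_v(G_t)$ is the number of triangles of $G_t$ incident to $v$ (this distribution depends neither on $v\in V$ nor on $t$). Then $$\mathbf{E}\,\Delta\ \ge\ \frac{\lambda}{4(\lambda_0+\mu_0+\lambda)}\,\mathbf{P}\{d\ge2\}.$$
   Context: For a graph $G=(V,E)$ and distinct $i,j\in V$ let $N_{ij}(G)$ be the set of common neighbours of $i$ and $j$ in $G$, let $d_v(G)$ be the degree of $v$ in $G$, and for $s\ge0$ let $$\nu_{ij}(G,s)=\sum_{v\in N_{ij}(G)}(d_v(G))^{-s}.$$ The network Markov chain is the continuous time Markov chain whose states are the graphs on $V$ and in which, from the state $G=(V,E)$, each pair $\{i,j\}\subset V$ toggles its adjacency status (the edge is inserted if absent and removed if present) at rate $$a_{ij}(G)=\begin{cases}\lambda_0+\lambda\,\nu_{ij}(G,\alpha)&\text{for }\{i,j\}\notin E,\\ \left(\mu_0-\mu\,\nu_{ij}(G,\beta)\right)_+&\text{for }\{i,j\}\in E,\end{cases}$$ where $x_+=\max\{x,0\}$. That is, given the current state, the pairs are assigned independent exponential waiting times with intensities $a_{ij}(G)$ and the pair with the smallest waiting time toggles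 its status. This chain has a unique stationary distribution; the stationary chain is the one whose initial state $G_0$ has this distribution. *)

(* Defs.v *)
(* MathComp / MathComp-Analysis *)
From HB Require Import structures.
From mathcomp Require Import all_boot all_order all_algebra.
From mathcomp Require Import all_classical all_reals all_analysis.

Set Implicit Arguments.
Unset Strict Implicit.
Unset Printing Implicit Defensive.

Import Order.TTheory GRing.Theory Num.Theory.
Import numFieldNormedType.Exports.
Local Open Scope classical_set_scope.
Local Open Scope ring_scope.

(* An unordered pair {i, j} of distinct vertices is encoded as (i, j) with
   i < j, so that a graph on {0, ..., n-1} is just a set of pairs. *)
Definition vpair (n : nat) := {p : 'I_n * 'I_n | (p.1 < p.2)%N}.

Definition graph (n : nat) := {set vpair n}.

Definition adj n (G : graph n) (i j : 'I_n) : bool :=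
  [exists p in G, (val p == (i, j)) || (val p == (j, i))].

Definition deg n (G : graph n) (v : 'I_n) : nat := #|[set u | adj G v u]%SET|.

Definition common_nbrs n (G : graph n) (i j : 'I_n) : {set 'I_n} :=
  [set v | adj G i v && adj G j v]%SET.

(* Each triangle at v is counted once, through its edge p opposite to v. *)
Definition triangles n (G : graph n) (v : 'I_n) : nat :=
  #|[set p : vpair n | [&& p \in G, adj G v (val p).1 & adj G v (val p).2]]%SET|.

Definition nu (R : realType) n (G : graph n) (i j : 'I_n) (s : R) : R :=
  \sum_(v in common_nbrs G i j) ((deg G v)%:R `^ (- s)).

Definition toggle_rate (R : realType) (alpha beta lambda lambda0 mu mu0 : R)
    n (G : graph n) (p : vpair n) : R :=
  let: (i, j) := val p in
  if adj G i j then Num.max (mu0 - mu * nu G i j beta) 0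
  else lambda0 + lambda * nu G i j alpha.

Definition toggle n (G : graph n) (p : vpair n) : graph n :=
  if p \in G then (G :\ p)%SET else (p |: G)%SET.

Definition network_rates (R : realType)
    (alpha beta lambda lambda0 mu mu0 : R) n (G H : graph n) : R :=
  let a := toggle_rate alpha beta lambda lambda0 mu mu0 in
  if H == G then - \sum_(p : vpair n) a n G p
  else \sum_(p : vpair n | toggle G p == H) a n G p.

(* [p t x y] is the probability of moving from x to y in time t >= 0; the
   matrix [q] of transition rates is the derivative of [p] at time 0. *)
Record transition_function (R : realType) (S : finType)
    (q : S -> S -> R) (p : R -> S -> S -> R) : Prop := {
  trans_ge0 : forall (t : R) x y, 0 <= t -> 0 <= p t x y ;
  trans_sum1 : forall (t : R) x, 0 <= t -> \sum_y p t x y = 1 ;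
  trans_0 : forall x y, p 0 x y = (x == y)%:R ;
  trans_chapman_kolmogorov : forall (s t : R) x y, 0 <= s -> 0 <= t ->
    p (s + t) x y = \sum_z p s x z * p t z y ;
  trans_rates : forall x y,
    (p h x y - (x == y)%:R) / h @[h --> 0^'+] --> q x y }.

Record stationary_distribution (R : realType) (S : finType)
    (p : R -> S -> S -> R) (pi : S -> R) : Prop := {
  stat_ge0 : forall x, 0 <= pi x ;
  stat_sum1 : \sum_x pi x = 1 ;
  stat_invariant : forall (t : R) y, 0 <= t -> \sum_x pi x * p t x y = pi y }.

(* [X t] is only constrained for t >= 0. *)
Record markov_chain (R : realType) (S : finType) (p : R -> S -> S -> R)
    (disp : measure_display) (Omega : measurableType disp)
    (P : probability Omega R) (X : R -> Omega -> S) : Prop := {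
  chain_measurable : forall (t : R) x, 0 <= t ->
    measurable [set w | X t w = x] ;
  chain_fdd : forall (m : nat) (t : nat -> R) (x : nat -> S),
    t 0%N = 0 -> (forall k, t k <= t k.+1) ->
    P [set w | forall k, (k <= m)%N -> X (t k) w = x k] =
    (P [set w | X 0%R w = x 0%N] *
     (\prod_(k < m) p (t k.+1 - t k) (x k) (x k.+1))%R%:E)%E ;
  chain_right_continuous :
    {ae P, forall w, forall t : R, 0 <= t -> \forall s \near t^'+, X s w = X t w} }.

(* Main.v *)
(** The trace of the cube of the adjacency matrix counts triangles: toggling the
    pair p changes it by 6 |N_p| if p is inserted and by - 6 |N_p| if p is
    removed. In stationarity the expected drift of this functional vanishes, so
    creation and destruction of triangles balance. Each edge disappears at rate
    at most mu0, so destruction is at most mu0 E (sum_v Delta_v). A nonadjacent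
    pair p appears at rate at least lambda nu_p, so creation is at least
    lambda E (sum_v d_v^-alpha (d_v (d_v - 1) / 2 - Delta_v)), and since
    alpha <= 2 the summand at v is at least (1{d_v >= 2} - Delta_v) / 4. The
    stationary distribution is unique because every graph leads to the complete
    graph; hence it is exchangeable in the vertices and the inequality summed
    over v holds for each v. *)

Require Import Defs.
From HB Require Import structures.
From mathcomp Require Import all_boot all_order all_algebra.
From mathcomp Require Import all_classical all_reals all_analysis.
From mathcomp Require Import fingroup perm measurable_realfun ring lra.

Set Implicit Arguments.
Unset Strict Implicit.
Unset Printing Implicit Defensive.

Import Order.TTheory GRing.Theory Num.Theory.
Import numFieldNormedType.Exports.
Local Open Scope classical_set_scope.
Local Open Scope ring_scope.

(** * Pairs, adjacency and toggling *)

(** The unordered pair encoded by [p] is {i, j}. Being symmetric in [i] and [j], this relation hides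
    the ordering built into [vpair]. *)
Definition joins n (p : vpair n) (i j : 'I_n) : bool :=
  (val p == (i, j)) || (val p == (j, i)).

Lemma joins_sym n (p : vpair n) i j : joins p i j = joins p j i.
Proof. by rewrite /joins orbC. Qed.

Lemma joins_irr n (p : vpair n) i : joins p i i = false.
Proof.
rewrite /joins orbb; apply/negP => /eqP e.
by have := valP p; rewrite e /= ltnn.
Qed.

Lemma joins_val n (p : vpair n) : joins p (val p).1 (val p).2.
Proof. by rewrite /joins -surjective_pairing eqxx. Qed.

Lemma joins_inj n (p q : vpair n) i j :
  joins p i j -> joins q i j -> p = q.
Proof.
case: p q => [[a b] /= ab] [[c d] /= cd]; rewrite /joins /=.
move=> /orP[] /eqP[? ?] /orP[] /eqP[? ?]; subst; apply: val_inj => //=;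
  by have := ltn_trans ab cd; rewrite ltnn.
Qed.

Lemma joinsE n (p q : vpair n) : joins p (val q).1 (val q).2 = (p == q).
Proof.
apply/idP/eqP => [h|->]; last exact: joins_val.
exact: joins_inj h (joins_val q).
Qed.

Lemma joins_ex n (i j : 'I_n) : i != j -> exists p : vpair n, joins p i j.
Proof.
rewrite neq_ltn => /orP[] h.
  by exists (exist _ (i, j) h); rewrite /joins /= eqxx.
by exists (exist _ (j, i) h); rewrite /joins /= eqxx orbT.
Qed.

Lemma adj_sym n (g : graph n) i j : adj g i j = adj g j i.
Proof. by apply: eq_existsb => p; rewrite orbC. Qed.

Lemma adj_irr n (g : graph n) i : adj g i i = false.
Proof.
by apply/existsP => -[p /andP[_ h]]; have := joins_irr p i; rewrite /joins h.
Qed.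

Lemma adj_pair n (g : graph n) (p : vpair n) i j :
  joins p i j -> adj g i j = (p \in g).
Proof.
move=> h; apply/existsP/idP => [[q /andP[qg hq]]|pg].
  by rewrite (joins_inj h hq).
by exists p; rewrite pg.
Qed.

Lemma adj_val n (g : graph n) (p : vpair n) :
  adj g (val p).1 (val p).2 = (p \in g).
Proof. exact/adj_pair/joins_val. Qed.

Lemma adj_inj n (g h : graph n) : adj g =2 adj h -> g = h.
Proof. by move=> e; apply/setP => p; rewrite -!adj_val e. Qed.

(** Exclusive or covers insertion and removal at once. Both the matrix identity for toggling and the
    compatibility with relabelling follow from this form. *)
Lemma adj_toggle n (g : graph n) (p : vpair n) i j :
  adj (toggle g p) i j = adj g i j (+) joins p i j.
Proof.
have [->|ij] := eqVneq i j; first by rewrite !adj_irr joins_irr.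
have [q hq] := joins_ex ij.
rewrite !(adj_pair _ hq).
have -> : joins p i j = (p == q).
  by apply/idP/eqP => [h|->//]; apply: joins_inj h hq.
rewrite /toggle; case: ifP => pg; rewrite !inE eq_sym; have [<-|] := eqVneq p q;
  by rewrite ?pg ?addbF.
Qed.

Lemma toggle_neq n (g : graph n) p : toggle g p != g.
Proof.
apply/eqP => e; have := adj_toggle g p (val p).1 (val p).2.
by rewrite e joins_val addbT; case: (adj _ _ _).
Qed.

Lemma toggle_rate_val (R : realType) (al be la la0 mu mu0 : R) n (g : graph n)
    (p : vpair n) :
  toggle_rate al be la la0 mu mu0 g p =
  if p \in g then Num.max (mu0 - mu * nu g (val p).1 (val p).2 be) 0
  else la0 + la * nu g (val p).1 (val p).2 al.
Proof. by rewrite -adj_val /toggle_rate; case: (val p). Qed.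

(** The ordered pairs split into those with i < j and those with j < i; by symmetry each half is the
    sum over [vpair n]. *)
Lemma sum_pairs (R : realType) n (F : 'I_n -> 'I_n -> R) :
  (forall i j, F i j = F j i) ->
  \sum_i \sum_(j | j != i) F i j = 2 * \sum_(p : vpair n) F (val p).1 (val p).2.
Proof.
move=> sF.
have lt_sum : \sum_(i : 'I_n) \sum_(j : 'I_n | (i < j)%N) F i j =
    \sum_(p : vpair n) F (val p).1 (val p).2.
  rewrite pair_big_dep /=.
  rewrite (eq_bigl (fun p : 'I_n * 'I_n => p \in [pred p : 'I_n * 'I_n | (p.1 < p.2)%N])) //.
  by rewrite big_sub.
have gt_sum : \sum_(i : 'I_n) \sum_(j : 'I_n | (j < i)%N) F i j =
    \sum_(p : vpair n) F (val p).1 (val p).2.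
  rewrite -lt_sum (exchange_big_dep xpredT) //=.
  by apply: eq_bigr => i _; apply: eq_bigr => j _.
rewrite mulr_natl mulr2n -{1}lt_sum -gt_sum -big_split /=.
apply: eq_bigr => i _.
rewrite (bigID (fun j : 'I_n => (i < j)%N)) /=; congr (_ + _); apply: eq_bigl => j.
  by rewrite neq_ltn orbC; case: ltngtP.
by rewrite neq_ltn -leqNgt; case: ltngtP.
Qed.

Definition adj_mx (R : realType) n (g : graph n) : 'M[R]_n :=
  \matrix_(i, j) (adj g i j)%:R.
Definition pair_mx (R : realType) n (p : vpair n) : 'M[R]_n :=
  \matrix_(i, j) (joins p i j)%:R.

Definition wedges n (g : graph n) (p : vpair n) : nat :=
  #|common_nbrs g (val p).1 (val p).2|.

(** * Triangle counts *)

Section TraceCube.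
Variables (R : realType) (n : nat).
Implicit Types (g : graph n) (p : vpair n).

Lemma adj_mx_toggle g p :
  adj_mx R (toggle g p) = adj_mx R g + (-1) ^+ (p \in g) *: pair_mx R p.
Proof.
apply/matrixP => i j; rewrite !mxE adj_toggle.
have [h|] := boolP (joins p i j); last by rewrite mulr0 addr0 addbF.
by rewrite (adj_pair _ h); case: (p \in g); rewrite /= ?expr1 ?expr0; ring.
Qed.

(** The matrix of [p] has two unit entries, one per orientation of [p], and the matching entry of
    the squared adjacency matrix counts common neighbours. *)
Lemma trace_pair_mx g p :
  \tr (adj_mx R g *m adj_mx R g *m pair_mx R p) = 2 * (wedges g p)%:R.
Proof.
rewrite /mxtrace.
under eq_bigr => i _.
  rewrite mxE (bigD1 i) //= [pair_mx _ _ _ _]mxE joins_irr mulr0 add0r.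
  over.
rewrite (@sum_pairs R n (fun i j => (adj_mx R g *m adj_mx R g) i j * pair_mx R p j i)); last first.
  move=> i j; rewrite ![pair_mx _ _ _ _]mxE joins_sym; congr (_ * _).
  rewrite !mxE; apply: eq_bigr => k _.
  by rewrite !mxE mulrC adj_sym [adj _ i k]adj_sym.
congr (_ * _); rewrite (bigD1 p) //= big1 ?addr0 => [|q qp].
  rewrite [pair_mx _ _ _ _]mxE joins_sym joins_val mulr1 mxE /wedges.
  rewrite -sum1_card natr_sum [RHS]big_mkcond /=; apply: eq_bigr => k _.
  rewrite !mxE inE -natrM mulnb [adj g k _]adj_sym.
  by case: (_ && _).
by rewrite [pair_mx _ _ _ _]mxE joins_sym joinsE eq_sym (negPf qp) mulr0.
Qed.

(** A walk of two steps along a single edge returns to its start, so the square of [pair_mx] is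
    diagonal and meets only the diagonal of [M]. *)
Lemma trace_pair_mx_sqr p (M : 'M[R]_n) : (forall i, M i i = 0) ->
  \tr (pair_mx R p *m pair_mx R p *m M) = 0.
Proof.
move=> M0; apply: big1 => i _; rewrite mxE; apply: big1 => j _.
have [->|ij] := eqVneq i j; first by rewrite M0 mulr0.
rewrite mxE big1 ?mul0r // => k _; rewrite !mxE.
have [h1|] := boolP (joins p i k); last by rewrite mul0r.
have [h2|] := boolP (joins p k j); last by rewrite mulr0.
move: h1 h2 ij; rewrite /joins; case: (val p) (valP p) => a b /= ab.
move=> /orP[] /eqP[? ?] /orP[] /eqP[? ?]; subst; rewrite ?eqxx //;
  by rewrite ltnn in ab.
Qed.

Definition trace_cube g : R := \tr (adj_mx R g *m adj_mx R g *m adj_mx R g).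

(** Expand the cube of A + cB with c = 1 or -1. By cyclicity of the trace the three terms linear in
    B coincide, each giving twice the number of common neighbours; the terms with two or three
    factors B have trace 0. *)
Lemma trace_cube_toggle g p :
  trace_cube (toggle g p) - trace_cube g =
  6 * (-1) ^+ (p \in g) * (wedges g p)%:R.
Proof.
rewrite /trace_cube adj_mx_toggle.
set A := adj_mx R g; set c := (-1) ^+ _; set B := pair_mx R p.
have tA2B : \tr (A *m A *m B) = 2 * (wedges g p)%:R by exact: trace_pair_mx.
have tB2A : \tr (B *m B *m A) = 0.
  by apply: trace_pair_mx_sqr => i; rewrite mxE adj_irr.
have tB3 : \tr (B *m B *m B) = 0.
  by apply: trace_pair_mx_sqr => i; rewrite mxE joins_irr.
have tABA : \tr (A *m B *m A) = \tr (A *m A *m B).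
  by rewrite mxtrace_mulC mulmxA.
have tBAA : \tr (B *m A *m A) = \tr (A *m A *m B).
  by rewrite -mulmxA mxtrace_mulC.
have tBAB : \tr (B *m A *m B) = \tr (B *m B *m A).
  by rewrite mxtrace_mulC mulmxA.
have tABB : \tr (A *m B *m B) = \tr (B *m B *m A).
  by rewrite -mulmxA mxtrace_mulC.
rewrite !(mulmxDl, mulmxDr, =^~ scalemxAl, =^~ scalemxAr) !(mxtraceD, mxtraceZ).
rewrite tABA tBAA tBAB tABB tA2B tB2A tB3; ring.
Qed.

End TraceCube.

(** * Double counting of triangles and of pairs of neighbours *)

Section Counting.
Variables (R : realType) (n : nat).
Implicit Types (g : graph n) (p : vpair n).

Lemma in_common_nbrs g p v :
  (v \in common_nbrs g (val p).1 (val p).2) =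
  adj g v (val p).1 && adj g v (val p).2.
Proof. by rewrite inE ![adj g v _]adj_sym. Qed.

(** Double counting of the incidences between an edge and a common neighbour of its ends. *)
Lemma sum_triangles g :
  \sum_v (triangles g v)%:R = \sum_(p in g) (wedges g p)%:R :> R.
Proof.
have -> : \sum_v (triangles g v)%:R =
  \sum_v \sum_(p in g) (v \in common_nbrs g (val p).1 (val p).2)%:R :> R.
  apply: eq_bigr => v _; rewrite /triangles -sum1_card natr_sum.
  rewrite big_mkcond [RHS]big_mkcond; apply: eq_bigr => p _ /=.
  by rewrite inE in_common_nbrs; case: (p \in g) => //=; case: (_ && _).
rewrite exchange_big /=; apply: eq_bigr => p _.
rewrite /wedges -sum1_card natr_sum [RHS]big_mkcond; apply: eq_bigr => v _ /=.
by case: (_ \in _).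
Qed.

(** The pairs having [v] as a common neighbour are the pairs of neighbours of [v]. Over ordered
    pairs the full square of the degree loses its diagonal, which contributes the degree. *)
Lemma count_pairs g v :
  2 * \sum_(p : vpair n) (v \in common_nbrs g (val p).1 (val p).2)%:R =
  (deg g v)%:R ^+ 2 - (deg g v)%:R :> R.
Proof.
have dE : (deg g v)%:R = \sum_u (adj g v u)%:R :> R.
  rewrite /deg -sum1_card natr_sum big_mkcond; apply: eq_bigr => u _ /=.
  by rewrite inE; case: (adj _ _ _).
have := @sum_pairs R n (fun i j => (adj g v i)%:R * (adj g v j)%:R).
move=> /(_ (fun i j => mulrC _ _)) sE.
under eq_bigr => p _ do rewrite in_common_nbrs -mulnb natrM.
rewrite -sE expr2 {1 2}dE mulr_suml dE -sumrB; apply: eq_bigr => i _.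
rewrite -mulr_sumr [in RHS](bigD1 i) //= mulrDr.
by case: (adj g v i) => /=; ring.
Qed.

(** The number of paths of length two centred at [v] that are not closed to a triangle. *)
Definition open_pairs g v : R :=
  \sum_(p | p \notin g) (v \in common_nbrs g (val p).1 (val p).2)%:R.

Lemma open_pairsE g v :
  2 * (open_pairs g v + (triangles g v)%:R) =
  (deg g v)%:R ^+ 2 - (deg g v)%:R.
Proof.
rewrite -count_pairs (bigID (mem g)) /= addrC; congr (_ * (_ + _)).
rewrite /triangles -sum1_card natr_sum.
rewrite big_mkcond [RHS]big_mkcond; apply: eq_bigr => p _ /=.
by rewrite inE in_common_nbrs; case: (p \in g) => //=; case: (_ && _).
Qed.

Lemma open_pairs_ge0 g v : 0 <= open_pairs g v.
Proof. by apply: sumr_ge0. Qed.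

(** Let d be the degree, T the triangle count and W = d(d-1)/2 - T. For d >= 2 the right side is at
    least W/d^2, where d(d-1)/2 >= d^2/4 and T/d^2 <= T/4. *)
Lemma vertex_bound (al : R) g v : al <= 2 ->
  4^-1 * (2 <= deg g v)%:R - 4^-1 * (triangles g v)%:R
  <= (deg g v)%:R `^ (- al) * open_pairs g v.
Proof.
move=> al2; have := open_pairsE g v; have := open_pairs_ge0 g v.
set W := open_pairs g v; set T := (triangles g v)%:R => W0.
have T0 : 0 <= T by rewrite ler0n.
set d := deg g v => e.
(* For d < 2 the left side is at most 0. *)
have [d2|d2] := leqP 2 d; last first.
  by rewrite mulr0 sub0r; apply: le_trans (mulr_ge0 (powR_ge0 _ _) W0); lra.
have dR : 2 <= d%:R :> R by rewrite ler_nat.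
have d0 : 0 < d%:R :> R by lra.
(* The exponent [al] is raised to 2, which decreases the power since the base is at least 1. *)
apply: (@le_trans _ _ ((d%:R ^+ 2)^-1 * W)); last first.
  apply: ler_wpM2r => //.
  rewrite -powR_mulrn; last lra.
  by rewrite -powRN ler_powR; lra.
rewrite [leRHS]mulrC ler_pdivlMr; last by apply: exprn_gt0.
move: dR e; set D : R := d%:R => dR e; rewrite /= mulr1.
(* These two products express T/D^2 <= T/4 and D(D-1)/2 >= D^2/4 without division. *)
have : 0 <= T * (D ^+ 2 - 4) by apply: mulr_ge0 => //; nra.
have : 0 <= D * (D - 2) by apply: mulr_ge0; lra.
nra.
Qed.

End Counting.

(** * Invariant measures of finite rate matrices *)

Section FiniteChain.
Variables (R : realType) (S : finType) (q : S -> S -> R).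

(** The invariance of [pi] is differentiated at time 0: the averaged difference quotient is 0 for
    every h > 0 and also tends to the averaged rate. *)
Lemma stationary_rates (p : R -> S -> S -> R) (pi : S -> R) :
  transition_function q p -> stationary_distribution p pi ->
  forall y, \sum_x pi x * q x y = 0.
Proof.
move=> hp hpi y.
have lim_q : \sum_x pi x * ((p h x y - (x == y)%:R) / h) @[h --> (0 : R)^'+]
    --> \sum_x pi x * q x y.
  apply: cvg_big => [|x _]; [exact: add_continuous|apply: cvgM]; first exact: cvg_cst.
  exact: (trans_rates hp).
have lim_0 : \sum_x pi x * ((p h x y - (x == y)%:R) / h) @[h --> (0 : R)^'+]
    --> (0 : R).
  apply: cvg_near_cst; near=> h.
  have h0 : 0 <= h by near: h; apply: filterS (nbhs_right_gt 0) => z /ltW.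
  under eq_bigr => x _ do rewrite mulrA mulrBr.
  rewrite -mulr_suml sumrB (stat_invariant hpi _ h0).
  rewrite (bigD1 y) //= eqxx mulr1 big1 ?addr0 ?subrr ?mul0r // => x xy.
  by rewrite (negPf xy) mulr0.
exact: (cvg_unique _ lim_q lim_0).
Unshelve. all: by end_near.
Qed.

Hypothesis q_ge0 : forall x y, x != y -> 0 <= q x y.
Hypothesis q_sum0 : forall x, \sum_y q x y = 0.

(* Positive parts are subinvariant, and total mass is conserved. *)
Lemma pos_part_invariant (h : S -> R) :
  (forall y, \sum_x h x * q x y = 0) ->
  forall y, \sum_x Num.max (h x) 0 * q x y = 0.
Proof.
move=> hq.
have ge0 y : 0 <= \sum_x Num.max (h x) 0 * q x y.
  (* If [h y] is at most 0, the diagonal term, the only one that may be negative, vanishes.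
     Otherwise it is the one for [h], while the other terms can only grow when [h] is replaced by
     its positive part. *)
  have [h0|h0] := leP (h y) 0.
    rewrite (bigD1 y) //= (max_r h0) mul0r add0r; apply: sumr_ge0 => x xy.
    by rewrite mulr_ge0 ?q_ge0 // le_max lexx orbT.
  rewrite -[leLHS](hq y) (bigD1 y) //= [leRHS](bigD1 y) //= (max_l (ltW h0)).
  apply: lerD => //; apply: ler_sum => x xy.
  by rewrite ler_wpM2r ?q_ge0 // le_max lexx.
have : \sum_y \sum_x Num.max (h x) 0 * q x y = 0.
  rewrite exchange_big big1 //= => x _.
  by rewrite -mulr_sumr q_sum0 mulr0.
move=> /eqP; rewrite psumr_eq0 // => /allP h0 y.
by have /implyP/(_ isT)/eqP := h0 y (mem_index_enum y).
Qed.

(** Positivity passes along each transition: were [u y] zero, the balance at [y] would be a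
    vanishing sum of nonnegative inflows, which excludes inflow from a charged [x] with a positive
    rate to [y]. *)
Lemma invariant_pos_connect (u : S -> R) (x z : S) :
  (forall y, 0 <= u y) -> (forall y, \sum_x u x * q x y = 0) ->
  connect (fun x y => (x != y) && (0 < q x y)) x z -> 0 < u x -> 0 < u z.
Proof.
move=> u0 uq /connectP[s]; elim: s x => [|y s IH] x /=; first by move=> _ ->.
move=> /andP[/andP[xy qxy] sp] zE ux; apply: (IH y) => //.
rewrite lt_neqAle u0 andbT eq_sym; apply/negP => /eqP uy.
have := uq y; rewrite (bigD1 y) //= uy mul0r add0r => /eqP.
rewrite psumr_eq0 => [/allP/(_ x (mem_index_enum x))|w wy]; last first.
  by rewrite mulr_ge0 ?q_ge0.
by rewrite xy /= mulf_eq0 !gt_eqF.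
Qed.

(* If nonzero, the positive and the negative part of [h] would both be invariant
   and charge [z]. *)
Lemma invariant_sum0_eq0 (z : S) (h : S -> R) :
  (forall x, connect (fun x y => (x != y) && (0 < q x y)) x z) ->
  (forall y, \sum_x h x * q x y = 0) -> \sum_x h x = 0 -> forall x, h x = 0.
Proof.
move=> cz.
have pos (f : S -> R) x : (forall y, \sum_x f x * q x y = 0) ->
    0 < f x -> 0 < f z.
  move=> fq fx.
  suff : 0 < Num.max (f z) 0 by rewrite lt_max ltxx orbF.
  apply: (invariant_pos_connect (u := fun x => Num.max (f x) 0)) (cz x) _ => [y||].
  - by rewrite le_max lexx orbT.
  - exact: pos_part_invariant.
  - by rewrite lt_max fx.
(* A negative value of [f] would, by [pos] for [- f], make [f z] negative. So [f] is nonnegative,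
   and with sum 0 it vanishes. *)
have main (f : S -> R) : (forall y, \sum_x f x * q x y = 0) ->
    \sum_x f x = 0 -> 0 <= f z -> forall x, f x = 0.
  move=> fq f0 fz.
  have f_ge0 x : 0 <= f x.
    rewrite leNgt; apply/negP => fx.
    have : 0 < - f z.
      apply: (pos (fun x => - f x) x); last by rewrite oppr_gt0.
      by move=> y; under eq_bigr do rewrite mulNr; rewrite sumrN fq oppr0.
    by rewrite oppr_gt0 ltNge fz.
  move/eqP: f0; rewrite psumr_eq0 // => /allP f0 x.
  by have /implyP/(_ isT)/eqP := f0 x (mem_index_enum x).
move=> hq h0 x; have [hz|/ltW hz] := leP 0 (h z); first exact: main.
apply/eqP; rewrite -oppr_eq0; apply/eqP; apply: (main (fun x => - h x)).
- by move=> y; under eq_bigr do rewrite mulNr; rewrite sumrN hq oppr0.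
- by rewrite sumrN h0 oppr0.
- by rewrite oppr_ge0.
Qed.

End FiniteChain.

(** * Vertex permutations *)

Section Relabelling.
Variable n : nat.
Implicit Types (g : graph n) (p : vpair n) (s : {perm 'I_n}).

(** The pullback of [g] along [s]: vertex [v] of the new graph plays the role of [s v] in [g]. *)
Definition relabel s g : graph n :=
  [set p | adj g (s (val p).1) (s (val p).2)]%SET.

(** The image of [p] under [s], whose ends may have to be swapped to fit the encoding. The default
    [p] is never taken, since [s] keeps the two ends distinct. *)
Definition relabel_pair s p : vpair n :=
  odflt p [pick q | joins q (s (val p).1) (s (val p).2)].

Lemma joins_relabel_pair s p :
  joins (relabel_pair s p) (s (val p).1) (s (val p).2).
Proof.
rewrite /relabel_pair; case: pickP => //= no.
have ne : s (val p).1 != s (val p).2.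
  by rewrite (inj_eq perm_inj) -(inj_eq val_inj) /= neq_ltn (valP p).
by have [q /= hq] := joins_ex ne; have := no q; rewrite /= hq.
Qed.

Lemma joinsP p i j k l : joins p i j ->
  joins p k l = ((i, j) == (k, l)) || ((i, j) == (l, k)).
Proof.
rewrite /joins => /orP[] /eqP -> //.
by rewrite orbC !xpair_eqE andbC [X in _ || X]andbC.
Qed.

Lemma joins_relabel s p i j : joins (relabel_pair s p) (s i) (s j) = joins p i j.
Proof.
rewrite (joinsP _ _ (joins_relabel_pair s p)) (joinsP _ _ (joins_val p)).
by rewrite !xpair_eqE !(inj_eq perm_inj).
Qed.

Lemma relabel_pair_inj s : injective (relabel_pair s).
Proof.
move=> p q e; apply/eqP.
by rewrite -joinsE -(joins_relabel s) e joins_relabel joins_val.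
Qed.

(** The permutation may reverse the order of the two ends, hence the restriction to symmetric
    [F]. *)
Lemma relabel_pairE (T : Type) s (F : 'I_n -> 'I_n -> T) p :
  (forall i j, F i j = F j i) ->
  F (val (relabel_pair s p)).1 (val (relabel_pair s p)).2 =
  F (s (val p).1) (s (val p).2).
Proof. by move=> sF; case/orP: (joins_relabel_pair s p) => /eqP ->. Qed.

Lemma adj_relabel s g i j : adj (relabel s g) i j = adj g (s i) (s j).
Proof.
have [->|ij] := eqVneq i j; first by rewrite !adj_irr.
have [p hp] := joins_ex ij; rewrite (adj_pair _ hp) inE.
by case/orP: hp => /eqP -> //=; rewrite adj_sym.
Qed.

Lemma relabelK s : cancel (relabel s) (relabel (s^-1)%g).
Proof. by move=> g; apply: adj_inj => i j; rewrite !adj_relabel !permKV. Qed.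

Lemma relabel_inj s : injective (relabel s).
Proof. exact: can_inj (relabelK s). Qed.

Lemma toggle_relabel s g p :
  toggle (relabel s g) p = relabel s (toggle g (relabel_pair s p)).
Proof.
by apply: adj_inj => i j; rewrite adj_toggle !adj_relabel adj_toggle joins_relabel.
Qed.

Lemma deg_relabel s g v : deg (relabel s g) v = deg g (s v).
Proof.
rewrite /deg -[RHS](card_preimset _ (@perm_inj _ s)).
by apply: eq_card => u; rewrite !inE adj_relabel.
Qed.

Lemma in_relabel s g p : (p \in relabel s g) = (relabel_pair s p \in g).
Proof. by rewrite inE -(adj_pair _ (joins_relabel_pair s p)). Qed.

Lemma triangles_relabel s g v : triangles (relabel s g) v = triangles g (s v).
Proof.
rewrite /triangles -[RHS](card_preimset _ (@relabel_pair_inj s)).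
apply: eq_card => p; rewrite !inE -in_relabel inE !adj_relabel; congr (_ && _).
by rewrite (@relabel_pairE _ s (fun i j => adj g (s v) i && adj g (s v) j)) // => i j; rewrite andbC.
Qed.

Variable R : realType.

Lemma nu_sym g i j (a : R) : nu g i j a = nu g j i a.
Proof. by apply: eq_bigl => v; rewrite !inE andbC. Qed.

Lemma nu_relabel s g i j (a : R) : nu (relabel s g) i j a = nu g (s i) (s j) a.
Proof.
rewrite /nu [RHS](reindex_inj (@perm_inj _ s)); apply: eq_big => [v|v _].
  by rewrite !inE !adj_relabel.
by rewrite deg_relabel.
Qed.

Variables al be la la0 mu mu0 : R.

Lemma toggle_rate_relabel s g p :
  toggle_rate al be la la0 mu mu0 (relabel s g) p =
  toggle_rate al be la la0 mu mu0 g (relabel_pair s p).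
Proof.
rewrite !toggle_rate_val in_relabel !nu_relabel.
rewrite (@relabel_pairE _ s (fun i j => nu g i j be)); last by move=> *; exact: nu_sym.
by rewrite (@relabel_pairE _ s (fun i j => nu g i j al)) // => *; exact: nu_sym.
Qed.

(** The rates depend only on adjacency and degrees, so relabelling merely permutes the pairs. *)
Lemma network_rates_relabel s g h :
  network_rates al be la la0 mu mu0 (relabel s g) (relabel s h) =
  network_rates al be la la0 mu mu0 g h.
Proof.
rewrite /network_rates (inj_eq (@relabel_inj s)).
(* The predicate [P] serves both the diagonal entry, a sum over all pairs, and the other entries,
   where the toggled graph is prescribed. *)
have reindex_pairs (P : pred (graph n)) :
    \sum_(p | P (toggle (relabel s g) p))
      toggle_rate al be la la0 mu mu0 (relabel s g) p =
    \sum_(p | P (relabel s (toggle g p))) toggle_rate al be la la0 mu mu0 g p.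
  rewrite [RHS](reindex_inj (@relabel_pair_inj s)).
  apply: eq_big => p; first by rewrite toggle_relabel.
  by rewrite toggle_rate_relabel.
move: reindex_pairs.
move: (toggle_rate _ _ _ _ _ _ (relabel s g)) (toggle_rate _ _ _ _ _ _ g).
move=> a1 a2 reindex_pairs.
case: ifP => _; first by congr (- _); exact: (reindex_pairs xpredT).
rewrite (reindex_pairs (eq_op^~ (relabel s h))).
by apply: eq_bigl => p; rewrite (inj_eq (@relabel_inj s)).
Qed.

End Relabelling.

(** * The stationary network chain *)

Section Stationary.
Variables (R : realType) (n : nat) (al be la la0 mu mu0 : R).
Hypotheses (hal : al <= 2) (hla : 0 < la) (hla0 : 0 < la0) (hmu : 0 < mu) (hmu0 : 0 < mu0).
Implicit Types (g : graph n) (p : vpair n).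
Local Notation a := (toggle_rate al be la la0 mu mu0).
Local Notation q := (@network_rates R al be la la0 mu mu0 n).

Lemma nu_ge0 g i j (s : R) : 0 <= nu g i j s.
Proof. by apply: sumr_ge0 => v _; exact: powR_ge0. Qed.

Lemma toggle_rate_ge0 g p : 0 <= a g p.
Proof.
rewrite toggle_rate_val; case: ifP => _; first by rewrite le_max lexx orbT.
by rewrite addr_ge0 ?mulr_ge0 ?nu_ge0 // ltW.
Qed.

(** The rate matrix acts on functions as the generator: off-diagonal entries are regrouped by the
    toggled pair, and the diagonal entry supplies the terms [- f g]. *)
Lemma network_generator g (f : graph n -> R) :
  \sum_h q g h * f h = \sum_p a g p * (f (toggle g p) - f g).
Proof.
under [RHS]eq_bigr => p _ do rewrite mulrBr.
rewrite sumrB -mulr_suml (bigD1 g) //= {1}/network_rates eqxx mulNr addrC.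
congr (_ - _).
transitivity (\sum_(h | h != g) \sum_(p | toggle g p == h) a g p * f (toggle g p)).
  apply: eq_bigr => h hg; rewrite /network_rates (negPf hg) mulr_suml.
  by apply: eq_bigr => p /eqP ->.
rewrite (exchange_big_dep xpredT) //=; apply: eq_bigr => p _.
rewrite (big_pred1 (toggle g p)) // => h /=.
by rewrite [RHS]eq_sym andbC; case: (toggle g p =P h) => // <-; rewrite toggle_neq.
Qed.

Lemma network_rates_sum0 g : \sum_h q g h = 0.
Proof.
have := network_generator g (fun=> 1).
under eq_bigr do rewrite mulr1.
by move=> ->; apply: big1 => p _; rewrite subrr mulr0.
Qed.

Lemma network_rates_ge0 g h : g != h -> 0 <= q g h.
Proof.
move=> gh; rewrite /network_rates eq_sym (negPf gh).
by apply: sumr_ge0 => p _; exact: toggle_rate_ge0.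
Qed.

(** An absent pair is inserted at rate at least [la0] > 0; induction on the number of absent
    pairs. *)
Lemma connect_complete g :
  connect (fun x y => (x != y) && (0 < q x y)) g [set: vpair n]%SET.
Proof.
have [m] := ubnP #|(~: g)%SET|; elim: m g => // m IH g; rewrite ltnS => gm.
have [/eqP e|[p]] := set_0Vmem (~: g)%SET.
  by move: e; rewrite -{2}[g]finset.setCK => /eqP ->; rewrite finset.setC0 connect0.
rewrite inE => pg.
have tE : toggle g p = (p |: g)%SET by rewrite /toggle (negPf pg).
apply: (@connect_trans _ _ (toggle g p)); last first.
  apply: IH; apply: leq_trans gm; apply: proper_card.
  rewrite tE properC properE finset.subsetUr /=; apply/negP => /fintype.subsetP /(_ p).
  by rewrite !inE eqxx (negPf pg) => /(_ isT).
apply: connect1; rewrite eq_sym toggle_neq /= /network_rates (negPf (toggle_neq _ _)).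
rewrite (bigD1 p) //=; apply: ltr_wpDr.
  by apply: sumr_ge0 => r _; exact: toggle_rate_ge0.
rewrite toggle_rate_val (negPf pg); apply: ltr_wpDr => //.
by rewrite mulr_ge0 ?nu_ge0 // ltW.
Qed.

(** * Exchangeability and balance of drift for an invariant distribution *)

Variable pi : graph n -> R.
Hypothesis pi_ge0 : forall g, 0 <= pi g.
Hypothesis pi_inv : forall h, \sum_g pi g * q g h = 0.

(** The relabelled weights are invariant too and have the same total mass, so the difference is an
    invariant function of sum 0 and vanishes. *)
Lemma pi_relabel s g : pi (relabel s g) = pi g.
Proof.
apply/eqP; rewrite -subr_eq0; apply/eqP.
apply: (invariant_sum0_eq0 network_rates_ge0 network_rates_sum0
  (h := fun g => pi (relabel s g) - pi g) connect_complete) => [h|].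
  under eq_bigr do rewrite mulrBl.
  rewrite sumrB pi_inv subr0.
  rewrite -[RHS](pi_inv (relabel s h)) [RHS](reindex_inj (@relabel_inj _ s)).
  by apply: eq_bigr => k _; rewrite network_rates_relabel.
by rewrite sumrB [X in _ - X](reindex_inj (@relabel_inj _ s)) subrr.
Qed.

(** Relabelling by the transposition of [v] and [w] preserves [pi] and carries one vertex to the
    other. *)
Lemma pi_exchangeable (F : graph n -> 'I_n -> R) (v w : 'I_n) :
  (forall s g u, F (relabel s g) u = F g (s u)) ->
  \sum_g pi g * F g v = \sum_g pi g * F g w.
Proof.
move=> hF; rewrite (reindex_inj (@relabel_inj _ (tperm v w))).
by apply: eq_bigr => g _; rewrite pi_relabel hF tpermL.
Qed.

Lemma pi_generator (f : graph n -> R) :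
  \sum_g pi g * (\sum_p a g p * (f (toggle g p) - f g)) = 0.
Proof.
under eq_bigr => g _ do rewrite -network_generator mulr_sumr.
rewrite exchange_big big1 //= => h _.
by under eq_bigr do rewrite mulrA; rewrite -mulr_suml pi_inv mul0r.
Qed.

(** The factor 1/6 turns [trace_cube] into the number of triangles, so the right side is the drift
    of that number in state [g]. Removals and insertions are bounded separately. *)
Lemma generator_bound g :
  \sum_v (la / 4 * (2 <= deg g v)%:R - (mu0 + la / 4) * (triangles g v)%:R)
  <= \sum_p a g p * (6^-1 * trace_cube R (toggle g p) - 6^-1 * trace_cube R g).
Proof.
rewrite [leRHS](eq_bigr (fun p => a g p * (-1) ^+ (p \in g) * (wedges g p)%:R));
  last first.
  move=> p _; rewrite -mulrBr trace_cube_toggle; by field.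
rewrite [leRHS](bigID (mem g)) /=.
have remove : - (mu0 * \sum_v (triangles g v)%:R) <=
    \sum_(p in g) a g p * (-1) ^+ (p \in g) * (wedges g p)%:R.
  rewrite sum_triangles mulr_sumr -sumrN; apply: ler_sum => p pg.
  rewrite toggle_rate_val pg expr1 mulrN1 mulNr lerN2.
  apply: ler_wpM2r; first exact: ler0n.
  by rewrite ge_max (ltW hmu0) andbT gerBl mulr_ge0 ?nu_ge0 // ltW.
(* Exchanging the sums over vertices and nonadjacent pairs turns the weighted open pairs into the
   sum of [nu] over these pairs. *)
have insert : la * \sum_v (deg g v)%:R `^ (- al) * open_pairs R g v <=
    \sum_(p | p \notin g) a g p * (-1) ^+ (p \in g) * (wedges g p)%:R.
  under eq_bigr do rewrite mulr_sumr.
  rewrite exchange_big mulr_sumr; apply: ler_sum => p pg /=.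
  rewrite toggle_rate_val (negPf pg) expr0 mulr1.
  have -> : \sum_i (deg g i)%:R `^ (- al) *
      (i \in common_nbrs g (val p).1 (val p).2)%:R = nu g (val p).1 (val p).2 al.
    rewrite /nu [RHS]big_mkcond; apply: eq_bigr => v _.
    by case: ifP; rewrite ?mulr1 ?mulr0.
  (* Without common neighbours [nu] is 0; otherwise the number of common neighbours is at least 1
     and multiplying by it only increases the bound. *)
  have [w0|w0] := posnP (wedges g p).
    rewrite w0 mulr0 /nu big1 ?mulr0 // => v.
    by move: w0 => /eqP; rewrite cards_eq0 => /eqP ->; rewrite inE.
  apply: (@le_trans _ _ (la * nu g (val p).1 (val p).2 al * (wedges g p)%:R)).
    by rewrite ler_peMr ?ler1n // mulr_ge0 ?nu_ge0 // ltW.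
  by rewrite ler_wpM2r // ler_wpDl // ltW.
apply: le_trans (lerD remove insert).
rewrite !mulr_sumr -sumrN -big_split /=; apply: ler_sum => v _.
have := @vertex_bound R n al g v hal.
move: (_ `^ _ * _) (_%:R) (_%:R) => X Y Z h.
have := ler_wpM2l (ltW hla) h; lra.
Qed.

(** The pointwise drift bound is averaged over [pi], where the drift vanishes; by exchangeability
    every vertex contributes the same to the resulting sum. *)
Lemma stationary_triangles (v : 'I_n) :
  la / 4 * (\sum_g pi g * (2 <= deg g v)%:R) <=
  (mu0 + la / 4) * \sum_g pi g * (triangles g v)%:R.
Proof.
pose F g u : R := la / 4 * (2 <= deg g u)%:R - (mu0 + la / 4) * (triangles g u)%:R.
have hF s g u : F (relabel s g) u = F g (s u).
  by rewrite /F deg_relabel triangles_relabel.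
suff : \sum_g pi g * F g v <= 0.
  move=> F0; rewrite -subr_le0 !mulr_sumr -sumrB; apply: le_trans F0.
  rewrite le_eqVlt; apply/orP; left; apply/eqP.
  by apply: eq_bigr => g _; rewrite /F; ring.
have : \sum_g pi g * \sum_u F g u <= 0.
  rewrite -[leRHS](pi_generator (fun g => 6^-1 * trace_cube R g)).
  by apply: ler_sum => g _; apply: ler_wpM2l => //; exact: generator_bound.
under eq_bigr do rewrite mulr_sumr.
rewrite exchange_big /=.
under eq_bigr => u _ do rewrite (pi_exchangeable u v hF).
(* The n equal terms can be divided by n, which is positive because [v] exists. *)
rewrite sumr_const card_ord pmulrn_lle0 //.
by case: (n) v => // -[].
Qed.

(** The mean triangle count is nonnegative, so its coefficient mu0 + la/4 may be enlarged to la0 +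
    mu0 + la. *)
Lemma stationary_bound (v : 'I_n) :
  la / (4 * (la0 + mu0 + la)) * (\sum_g pi g * (2 <= deg g v)%:R) <=
  \sum_g pi g * (triangles g v)%:R.
Proof.
have := stationary_triangles v.
have : 0 <= \sum_g pi g * (triangles g v)%:R.
  by apply: sumr_ge0 => g _; rewrite mulr_ge0.
move: (\sum_g _) (\sum_g _) => D T T0 h.
rewrite mulrAC ler_pdivrMr; last by rewrite mulr_gt0 ?addr_gt0 ?ltr0n.
have : 0 <= T * la0 by rewrite mulr_ge0 // ltW.
have : 0 <= T * la by rewrite mulr_ge0 // ltW.
lra.
Qed.

End Stationary.

(** * Transfer of laws *)

Section FiniteLaws.
Local Open Scope ereal_scope.
Context (disp : measure_display) (T : measurableType disp) (R : realType).
Variable mu : {measure set T -> \bar R}.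

Lemma indic_reflect (A : set T) (w : T) (b : bool) :
  reflect (A w) b -> \1_A w = b%:R :> R.
Proof.
move=> Ab; rewrite indicE; congr (_%:R); congr nat_of_bool.
by apply/idP/idP => [/set_mem/Ab|/Ab/mem_set].
Qed.

Lemma measurable_fun_comb (I : finType) (c : I -> R) (A : I -> set T) :
  (forall i, measurable (A i)) ->
  measurable_fun setT (fun w => \sum_i c i * \1_(A i) w)%R.
Proof.
move=> mA; apply: measurable_sum => i.
by apply: measurable_funM => //; exact: measurable_indic.
Qed.

Lemma integral_comb (I : finType) (c : I -> R) (A : I -> set T) :
  (forall i, measurable (A i)) -> (forall i, (0 <= c i)%R) ->
  \int[mu]_w (\sum_i c i * \1_(A i) w)%R%:E = \sum_i (c i)%:E * mu (A i).
Proof.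
move=> mA c0.
under eq_integral => w _ do rewrite -sumEFin.
have mi i : measurable_fun setT (fun w => (\1_(A i) w : R)%:E).
  by apply/measurable_EFinP; exact: measurable_indic.
rewrite ge0_integral_sum //=.
- apply: eq_bigr => i _; under eq_integral => w _ do rewrite EFinM.
  rewrite ge0_integralZl_EFin //= ?integral_indic ?setIT //.
- by move=> i; apply/measurable_EFinP; apply: measurable_funM => //; exact: measurable_indic.
- by move=> i w _; rewrite lee_fin mulr_ge0 // indicE ler0n.
Qed.

Lemma measure_comb (I : finType) (c : I -> R) (A : I -> set T) (B : set T) :
  measurable B -> (forall i, measurable (A i)) -> (forall i, (0 <= c i)%R) ->
  (forall w, \1_B w = \sum_i c i * \1_(A i) w)%R ->
  mu B = \sum_i (c i)%:E * mu (A i).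
Proof.
move=> mB mA c0 BE; rewrite -integral_comb // -[in LHS](setIT B).
by rewrite -integral_indic //; apply: eq_integral => w _; rewrite BE.
Qed.

Lemma le_integral_comb (I : finType) (c : I -> R) (A : I -> set T) (f : T -> R) :
  measurable_fun setT f ->
  (forall i, measurable (A i)) -> (forall i, (0 <= c i)%R) ->
  (forall w, \sum_i c i * \1_(A i) w <= f w)%R ->
  \sum_i (c i)%:E * mu (A i) <= \int[mu]_w (f w)%:E.
Proof.
move=> mf mA c0 le_f; rewrite -integral_comb //; apply: ge0_le_integral => //.
- move=> w _; rewrite lee_fin; apply: sumr_ge0 => i _.
  by rewrite mulr_ge0 // indicE ler0n.
- by apply/measurable_EFinP; exact: measurable_fun_comb.
- exact/measurable_EFinP.
- by move=> w _; rewrite lee_fin.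
Qed.

End FiniteLaws.

(** This truncates [c] to the box of values below [N]. For nonnegative [c] the truncation stays
    below [c]. *)
Lemma sum_delta (R : pzSemiRingType) (N : nat) (c : nat -> nat -> R) (a b : nat) :
  \sum_(i : 'I_N * 'I_N) c i.1 i.2 * ((a == i.1) && (b == i.2))%:R =
  if (a < N)%N && (b < N)%N then c a b else 0.
Proof.
case: ifP => [/andP[aN bN]|abN].
  rewrite (bigD1 (Ordinal aN, Ordinal bN)) //= !eqxx mulr1 big1 ?addr0 //.
  move=> [i j] ij /=; rewrite !xpair_eqE /= in ij.
  have -> : (a == i) && (b == j) = false; last by rewrite mulr0.
  by apply/negbTE; apply: contra ij; rewrite -!val_eqE /= => /andP[/eqP-> /eqP->]; rewrite !eqxx.
apply: big1 => -[i j] _ /=.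
case: andP => [[/eqP ai /eqP bj]|_]; last by rewrite mulr0.
by rewrite ai bj !ltn_ord in abN.
Qed.

(** * The law of the stationary chain at a fixed time and its transfer to another space *)

Section ChainLaw.
Context (R : realType) (S : finType) (p : R -> S -> S -> R) (pi : S -> R).
Context (disp : measure_display) (Omega : measurableType disp).
Variables (P : probability Omega R) (X : R -> Omega -> S).
Hypothesis pi_stat : stationary_distribution p pi.
Hypothesis X_chain : markov_chain p P X.
Hypothesis X0_law : forall x, P [set w | X 0 w = x] = (pi x)%:E.

(** The event is split according to the initial state, and the joint laws at times 0 and [t] add up
    to [pi y] by invariance. *)
Lemma stationary_chain_law (t : R) (y : S) : 0 <= t ->
  P [set w | X t w = y] = (pi y)%:E.
Proof.
move=> t0.
have joint x : P ([set w | X 0 w = x] `&` [set w | X t w = y]) =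
    (pi x * p t x y)%:E.
  (* The time sequence 0, t, t, ... is nondecreasing; only its indices 0 and 1 enter the event. *)
  have := chain_fdd X_chain 1 (t := fun k => if k is 0%N then 0 else t)
    (fun k => if k is 0%N then x else y) erefl.
  rewrite big_ord1 subr0 X0_law -EFinM => <- => [|[|k]] //.
  congr (P _); apply/seteqP; split => [w [/= h0 ht] [|[|k]] //|w /= h].
  by split; [exact: (h 0%N)|exact: (h 1%N)].
have mX := chain_measurable X_chain.
rewrite (measure_comb P (c := fun=> 1)
    (A := fun x => [set w | X 0 w = x] `&` [set w | X t w = y])) //.
- rewrite (eq_bigr (fun x => (pi x * p t x y)%:E)) => [|x _]; last first.
    by rewrite mul1e; exact: joint.
  by rewrite sumEFin (stat_invariant pi_stat).
- exact: mX.
- by move=> x; apply: measurableI; exact: mX.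
- move=> w; rewrite (bigD1 (X 0 w)) //= big1 => [|x xw]; last first.
    rewrite (@indic_reflect _ _ _ _ _ false) ?mulr0 //.
    by apply: ReflectF => -[/= e _]; rewrite e eqxx in xw.
  rewrite mul1r addr0 !indicE; congr (_%:R); congr nat_of_bool.
  by apply/idP/idP => /set_mem => [h|[_ h]]; apply/mem_set.
Qed.

(* [Delta] is only almost surely bounded on Omega': [f] is compared with a finite
   combination of level sets, which suffices for a lower bound. *)
Lemma stationary_le_integral (a b : S -> nat) (t : R)
    (disp' : measure_display) (Omega' : measurableType disp')
    (P' : probability Omega' R) (d Delta : {RV P' >-> nat})
    (c : nat -> nat -> R) (f : Omega' -> R) :
  0 <= t ->
  (forall k l : nat, P' [set w | d w = k /\ Delta w = l] =
    P [set w | a (X t w) = k /\ b (X t w) = l]) ->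
  (forall k l, 0 <= c k l) -> measurable_fun setT f ->
  (forall w, c (d w) (Delta w) <= f w) ->
  ((\sum_x pi x * c (a x) (b x))%:E <= \int[P']_w (f w)%:E)%E.
Proof.
move=> t0 hlaw c0 mf cf.
(* The state space is finite, so [N] exceeds all values of [a] and [b] and the truncation loses
   nothing on the side of the chain. *)
pose N := (\max_x a x + \max_x b x).+1.
have aN x : (a x < N)%N.
  by rewrite ltnS; apply: leq_trans (leq_addr _ _); exact: leq_bigmax.
have bN x : (b x < N)%N.
  by rewrite ltnS; apply: leq_trans (leq_addl _ _); exact: leq_bigmax.
have md (Y : {RV P' >-> nat}) k : measurable [set w | Y w = k].
  by rewrite -[X in measurable X]setTI; exact: (@measurable_funPT _ _ _ _ Y _ [set k]).
have XE k l : P [set w | a (X t w) = k /\ b (X t w) = l] =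
    (\sum_x ((a x == k) && (b x == l))%:R * pi x)%:E.
  rewrite (measure_comb P (c := fun x => ((a x == k) && (b x == l))%:R)
    (A := fun x => [set w | X t w = x])) //.
  - rewrite -sumEFin; apply: eq_bigr => x _.
    by rewrite [X in (_ * X)%E](stationary_chain_law x t0) -EFinM.
  - rewrite [X in measurable X](_ : _ =
        \bigcup_(x in [set x | a x = k /\ b x = l]) [set w | X t w = x]).
      by apply: fin_bigcup_measurable => // x _; exact: (chain_measurable X_chain).
    by apply/seteqP; split => [w /= h|w [x /= h ->]] //; exists (X t w).
  - by move=> x; exact: (chain_measurable X_chain).
  - move=> w; rewrite (bigD1 (X t w)) //= big1 => [|x xw]; last first.
      rewrite (@indic_reflect _ _ _ [set w0 | X t w0 = x] w false) ?mulr0 //.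
      by apply: ReflectF => /= e; rewrite e eqxx in xw.
    rewrite (@indic_reflect _ _ _ [set w0 | X t w0 = X t w] w true) ?mulr1 ?addr0.
      apply: indic_reflect; apply: (iffP andP) => /=.
        by move=> [/eqP-> /eqP->].
      by move=> [-> ->]; rewrite !eqxx.
    exact: ReflectT.
apply: le_trans (le_integral_comb P' (c := fun i : 'I_N * 'I_N => c i.1 i.2)
  (A := fun i => [set w | d w = i.1 /\ Delta w = i.2]) mf _ _ _).
- rewrite (eq_bigr (fun i : 'I_N * 'I_N => (\sum_x c i.1 i.2 *
      (((a x == i.1) && (b x == i.2))%:R * pi x))%:E)) => [|i _]; last first.
    by rewrite -mulr_sumr EFinM -XE -hlaw.
  rewrite sumEFin exchange_big lee_fin le_eqVlt; apply/orP; left; apply/eqP.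
  apply: eq_bigr => x _; under eq_bigr => i _ do rewrite mulrA.
  by rewrite -mulr_suml sum_delta aN bN mulrC.
- by move=> i; apply: measurableI; exact: md.
- by move=> i; exact: c0.
- move=> w.
  have := sum_delta N c (d w) (Delta w).
  under eq_bigr => i _.
    rewrite -(@indic_reflect _ _ R [set w | d w = i.1 /\ Delta w = i.2] w); last first.
      by apply: (iffP andP) => -[/eqP h1 /eqP h2].
    over.
  move=> ->; apply: le_trans (cf w).
  by case: ifP.
Qed.

End ChainLaw.

(** * The inequality for a vector distributed as degree and triangle count *)

Theorem mainTheorem5 (R : realType) (n : nat)
    (alpha beta lambda lambda0 mu mu0 : R)
    (hn : (2 <= n)%N) (halpha0 : 0 < alpha) (halpha2 : alpha <= 2)
    (hbeta : 0 <= beta) (hlambda : 0 < lambda) (hlambda0 : 0 < lambda0)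
    (hmu : 0 < mu) (hmu0 : 0 < mu0)
    (p : R -> graph n -> graph n -> R)
    (hp : transition_function
            (@network_rates R alpha beta lambda lambda0 mu mu0 n) p)
    (pi : graph n -> R) (hpi : stationary_distribution p pi)
    (disp : measure_display) (Omega : measurableType disp)
    (P : probability Omega R) (G : R -> Omega -> graph n)
    (hG : markov_chain p P G)
    (hG0 : forall g : graph n, P [set w | G 0 w = g] = (pi g)%:E)
    (v : 'I_n) (t : R) (ht : 0 <= t)
    (disp' : measure_display) (Omega' : measurableType disp')
    (P' : probability Omega' R) (d Delta : {RV P' >-> nat})
    (hlaw : forall k l : nat,
        P' [set w | d w = k /\ Delta w = l] =
        P [set w | deg (G t w) v = k /\ triangles (G t w) v = l]) :
  ((lambda / (4 * (lambda0 + mu0 + lambda)))%R%:E * P' [set w | (2 <= d w)%N]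
     <= 'E_P'[fun w => (Delta w)%:R%R])%E.
Proof.
have pi_inv := stationary_rates hp hpi.
have pi0 := stat_ge0 hpi.
have bound := stationary_bound halpha2 hlambda hlambda0 hmu hmu0 pi0 pi_inv v.
have mnat (Y : {RV P' >-> nat}) (A : set nat) : measurable [set w | A (Y w)].
  by rewrite -[X in measurable X]setTI; exact: (@measurable_funPT _ _ _ _ Y _ A).
have le_E : ((\sum_g pi g * (triangles g v)%:R)%:E <=
    'E_P'[fun w => (Delta w)%:R%R])%E.
  rewrite expectation.unlock.
  apply: (stationary_le_integral hpi hG hG0 (a := fun g => deg g v)
    (b := fun g => triangles g v) (c := fun _ l => l%:R) ht hlaw) => //.
  by move=> _ Y _; rewrite setTI; exact: (mnat Delta (fun m => Y m%:R)).
have m2 : measurable [set w | (d w < 2)%N] by exact: (mnat d (fun m => (m < 2)%N)).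
(* The transfer yields lower bounds only, so it is applied to the complementary event; the upper
   bound on the probability of degree at least 2 follows because both laws have mass 1. *)
have le_P : ((\sum_g pi g * (deg g v < 2)%:R)%:E <= P' [set w | (d w < 2)%N])%E.
  rewrite -[X in P' X]setIT -integral_indic //.
  apply: (stationary_le_integral hpi hG hG0 (a := fun g => deg g v)
    (b := fun g => triangles g v) (c := fun k _ => (k < 2)%:R) ht hlaw) => //.
  by move=> w; rewrite (@indic_reflect _ _ R [set w | (d w < 2)%N] w (d w < 2)%N idP).
have P2 : (P' [set w | (2 <= d w)%N] <= (\sum_g pi g * (2 <= deg g v)%:R)%:E)%E.
  have -> : [set w | (2 <= d w)%N] = ~` [set w | (d w < 2)%N].
    by apply/seteqP; split => w /=; [rewrite leqNgt => /negP|move/negP; rewrite -leqNgt].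
  rewrite probability_setC //.
  apply: (le_trans (leeB (lexx _) le_P)).
  rewrite -EFinB lee_fin -[X in X - _](stat_sum1 hpi) -sumrB; apply: ler_sum => g _.
  by rewrite ltnNge; case: (2 <= deg g v)%N; rewrite /= ?mulr0 ?mulr1 ?subrr ?subr0.
apply: le_trans le_E; apply: le_trans (lee_wpmul2l _ P2) _.
  by rewrite lee_fin divr_ge0 ?mulr_ge0 ?addr_ge0 // ltW.
by rewrite -EFinM lee_fin.
Qed.
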